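(* Let $\Sigma$ be a finite alphabet. The class of languages over $\Sigma$ recognized by counting automata over $\mathcal{P}(\Sigma)$ is closed under union, concatenation, and the Kleene star. That is, if $\mathcal{A}$ and $\mathcal{B}$ are counting automata over $\mathcal{P}(\Sigma)$ recognizing the languages $\mathcal{L}_{\mathcal{A}}$ and $\mathcal{L}_{\mathcal{B}}$ respectively, then there exist counting automata over $\mathcal{P}(\Sigma)$ recognizing $\mathcal{L}_{\mathcal{A}} \cup \mathcal{L}_{\mathcal{B}}$, $\mathcal{L}_{\mathcal{A}} \cdot \mathcal{L}_{\mathcal{B}}$, and $\mathcal{L}_{\mathcal{A}}^*$.
   Context: $\Sigma$ is a finite alphabet, $\Sigma^*$ is the set of finite words over $\Sigma$, and $\varepsilon$ is the empty word. The semiring of languages is $(\mathcal{P}(\Sigma^* ), \cup, \cdot, \emptyset, \{\varepsilon\})$, where $\mathcal{P}$ denotes the power set and $\cdot$ is concatenation of languages. $\mathcal{P}(\Sigma)$ is regarded as the subset of $\mathcal{P}(\Sigma^* )$ consisting of the languages all of whose words have length exactly 1 (sets of letters, including $\emptyset$). A counting automaton $\mathcal{A}$ over $\mathcal{P}(\Sigma)$ (a weighted automaton over a one-letter input alphabet with weights in $\mathcal{P}(\Sigma)$) consists of a finite set of states $Q_{\mathcal{A}} = \{f_1, \ldots, f_k\}$ ($k \ge 1$), a single initial state $f_1$, a set of final states $F_{\mathcal{A}} \subseteq Q_{\mathcal{A}}$, and for all $1 \le i,j \le k$ a transition weight $L_{ij} \in \mathcal{P}(\Sigma)$ of the transition $f_i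 \to f_j$ (with $L_{ij} = \emptyset$ meaning that there is no such transition). The final weight of $f_i$ is $c_i = \{\varepsilon\}$ if $f_i \in F_{\mathcal{A}}$ and $c_i = \emptyset$ if $f_i \notin F_{\mathcal{A}}$. Each state $f_i$ generates a function $f_i : \mathbb{N} \to \mathcal{P}(\Sigma^* )$ (with $0 \in \mathbb{N}$), where $f_i(n)$ is the union, over all paths $f_i = f_{i_0} \to f_{i_1} \to \cdots \to f_{i_n}$ of length $n$ starting at $f_i$, of the languages $L_{i_0 i_1} \cdot L_{i_1 i_2} \cdots L_{i_{n-1} i_n} \cdot c_{i_n}$. Equivalently, these functions are defined by the system $$f_i(n+1) = \bigcup_{j=1}^k L_{ij} \cdot f_j(n), \quad f_i(0) = c_i, \quad 1 \le i \le k.$$ The language recognized by $\mathcal{A}$ is $\mathcal{L}_{\mathcal{A}} = \bigcup_{n \in \mathbb{N}} f_1(n)$. *)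

(* Defs.v *)
From HB Require Import structures.
From mathcomp Require Import all_boot.
From mathcomp Require Import boolp classical_sets.

Set Implicit Arguments.
Unset Strict Implicit.
Unset Printing Implicit Defensive.

Local Open Scope classical_set_scope.

Definition language (Sigma : finType) := set (seq Sigma).

Section Languages.
Variable Sigma : finType.
Implicit Types L M : language Sigma.

Definition lang_eps : language Sigma := [set [::]].

Definition lang_cat L M : language Sigma :=
  [set w | exists u v, [/\ L u, M v & w = u ++ v]].

Definition lang_pow L (n : nat) : language Sigma := iter n (lang_cat L) lang_eps.

Definition lang_star L : language Sigma := \bigcup_n lang_pow L n.

(* The embedding of P(Sigma) into P(Sigma^* ) as sets of one-letter words. *)
Definition lang_letters (X : {set Sigma}) : language Sigma :=
  [set w | exists2 a : Sigma, a \in X & w = [:: a]].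

End Languages.

(* The states f_1, ..., f_k are the elements of 'I_k with k = ca_size.+1, so
   that k >= 1 is built in; the initial state f_1 is ord0. *)
Record counting_automaton (Sigma : finType) := CountingAutomaton {
  ca_size : nat;
  ca_final : {set 'I_ca_size.+1};
  ca_weight : 'I_ca_size.+1 -> 'I_ca_size.+1 -> {set Sigma}
}.

Section Semantics.
Variables (Sigma : finType) (A : counting_automaton Sigma).
Notation state := 'I_(ca_size A).+1.

Definition ca_final_weight (i : state) : language Sigma :=
  if i \in ca_final A then @lang_eps Sigma else set0.

(* The weight of the path i -> s_1 -> ... -> s_n, where s = [:: s_1; ...; s_n],
   including the final weight of its last state. *)
Fixpoint ca_path_weight (i : state) (s : seq state) : language Sigma :=
  if s is j :: s' then
    lang_cat (lang_letters (ca_weight i j)) (ca_path_weight j s')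
  else ca_final_weight i.

Definition ca_gen (i : state) (n : nat) : language Sigma :=
  \bigcup_(s in [set s : seq state | size s = n]) ca_path_weight i s.

Definition ca_language : language Sigma := \bigcup_n ca_gen ord0 n.

(* The equivalent recursive system for the functions f_i. *)
Lemma ca_gen0 (i : state) : ca_gen i 0 = ca_final_weight i.
Proof.
apply/seteqP; split=> [w [s /= /size0nil -> //]|w iw].
by exists [::].
Qed.

Lemma ca_genS (i : state) (n : nat) :
  ca_gen i n.+1 =
  \bigcup_(j : state) lang_cat (lang_letters (ca_weight i j)) (ca_gen j n).
Proof.
apply/seteqP; split=> w.
  move=> [[//|j s] /= [sn] [u [v [Lu sv ->]]]].
  by exists j => //; exists u, v; split=> //; exists s.
move=> [j _ [u [v [Lu [s /= sn sv] ->]]]].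
by exists (j :: s); rewrite /= ?sn //; exists u, v.
Qed.

End Semantics.

(* Main.v *)
(* Without silent transitions, the usual epsilon-free constructions apply: a
   transition that would silently enter an automaton at its initial state is
   replaced by copies of the transitions leaving that state, and a fresh initial
   state is added for the union and the star, so that the transitions which
   return to the original initial state do not interfere. *)
Require Import Defs.
From HB Require Import structures.
From mathcomp Require Import all_boot.
From mathcomp Require Import boolp classical_sets.

Set Implicit Arguments.
Unset Strict Implicit.
Unset Printing Implicit Defensive.

Local Open Scope classical_set_scope.

Section Acceptance.
Variables (Sigma T : finType) (F : pred T) (d : T -> T -> {set Sigma}).

(** The state type is an arbitrary finite type, so that the constructions below can use [option] and
    [+] instead of arithmetic on ordinals. *)
Fixpoint accepts (x : T) (w : seq Sigma) : Prop :=
  if w is a :: w' then exists2 y, a \in d x y & accepts y w' else F x.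

End Acceptance.

(** States with the same image under [h] behave alike, so [h] may identify several states; its right
    inverse [g] lifts each step back to [T']. *)
Lemma accepts_preim (Sigma T T' : finType) (F : pred T)
    (d : T -> T -> {set Sigma}) (h : T' -> T) (g : T -> T') (x : T')
    (w : seq Sigma) :
  cancel g h ->
  accepts (F \o h) (fun i j => d (h i) (h j)) x w <-> accepts F d (h x) w.
Proof.
move=> gK; elim: w x => [//|a w IH] x /=; split.
  by move=> [y ay /IH yw]; exists (h y).
by move=> [y ay yw]; exists (g y); rewrite ?gK //; apply/IH; rewrite gK.
Qed.

(** Every weight is a set of one-letter words, so a path spells a word letter by letter and its
    length is that of the word; the union over lengths thus reduces to the existence of a path. *)
Lemma ca_languageE (Sigma : finType) (A : counting_automaton Sigma) :
  ca_language A = accepts (fun i => i \in ca_final A) (@ca_weight _ A) ord0.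
Proof.
have accE w i : accepts (fun i => i \in ca_final A) (@ca_weight _ A) i w <->
    exists s, ca_path_weight i s w.
  split.
    elim: w i => [|a w IH] i /=.
      by move=> iF; exists [::]; rewrite /= /ca_final_weight iF.
    move=> [j aj /IH [s sw]].
    by exists (j :: s), [:: a], w; split=> //; exists a.
  move=> [s]; elim: s i w => [|j s IH] i w /=.
    by rewrite /ca_final_weight; case: ifP => // iF ->.
  by move=> [_ [v [[a aj ->] sv ->]]]; exists j => //; apply: IH.
apply/seteqP; split=> w.
  by move=> [n _ [s _ sw]]; apply/accE; exists s.
by move=> /accE [s sw]; exists (size s) => //; exists s.
Qed.

(* The index [ord0] is an additional copy of [x]: this makes [x] the initial
   state without having to reorder the enumeration of [T]. *)
Lemma accepts_recognizable (Sigma T : finType) (F : pred T)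
    (d : T -> T -> {set Sigma}) (x : T) :
  exists C : counting_automaton Sigma, ca_language C = accepts F d x.
Proof.
pose h (i : 'I_#|T|.+1) : T := oapp enum_val x (unlift ord0 i).
pose g (y : T) : 'I_#|T|.+1 := lift ord0 (enum_rank y).
have gK : cancel g h by move=> y; rewrite /h /g liftK /= enum_rankK.
have h0 : h ord0 = x by rewrite /h unlift_none.
exists (CountingAutomaton [set i | F (h i)]%SET (fun i j => d (h i) (h j))).
rewrite ca_languageE /=.
have -> : (fun i => i \in [set i | F (h i)]%SET) = F \o h.
  by apply/funext => i; rewrite inE.
by apply/seteqP; split=> w; [move=> /(accepts_preim _ _ _ _ gK)|
  move=> xw; apply/(accepts_preim _ _ _ _ gK)]; rewrite h0.
Qed.

Section Union.
Variables (Sigma T U : finType) (F : pred T) (G : pred U).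
Variables (d : T -> T -> {set Sigma}) (e : U -> U -> {set Sigma}) (x : T) (y : U).

Definition union_final (s : option (T + U)) : bool :=
  match s with
  | None => F x || G y
  | Some (inl t) => F t
  | Some (inr u) => G u
  end.

(** [None] is the fresh initial state: it copies the transitions leaving [x] and [y], and nothing
    leads back to it. *)
Definition union_step (s s' : option (T + U)) : {set Sigma} :=
  match s, s' with
  | None, Some (inl t') => d x t'
  | None, Some (inr u') => e y u'
  | Some (inl t), Some (inl t') => d t t'
  | Some (inr u), Some (inr u') => e u u'
  | _, _ => finset.set0
  end.

Lemma accepts_union_inl t :
  accepts union_final union_step (Some (inl t)) = accepts F d t.
Proof.
apply/seteqP; split=> w; elim: w t => [//|a w IH] t /=.
  by move=> [[[t'|u']|]] /=; rewrite ?inE // => at' /IH; exists t'.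
by move=> [t' at' /IH]; exists (Some (inl t')).
Qed.

Lemma accepts_union_inr u :
  accepts union_final union_step (Some (inr u)) = accepts G e u.
Proof.
apply/seteqP; split=> w; elim: w u => [//|a w IH] u /=.
  by move=> [[[t'|u']|]] /=; rewrite ?inE // => au' /IH; exists u'.
by move=> [u' au' /IH]; exists (Some (inr u')).
Qed.

Lemma accepts_union :
  accepts union_final union_step None = accepts F d x `|` accepts G e y.
Proof.
apply/seteqP; split=> [[|a w]|[|a w]] /=.
- by move=> /orP.
- move=> [[[t'|u']|]] /=; rewrite ?inE // => a'.
    by rewrite accepts_union_inl; left; exists t'.
  by rewrite accepts_union_inr; right; exists u'.
- by move=> /orP.
- case=> [[t' at']|[u' au']].
    by rewrite -accepts_union_inl; exists (Some (inl t')).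
  by rewrite -accepts_union_inr; exists (Some (inr u')).
Qed.

End Union.

Section Concatenation.
Variables (Sigma T U : finType) (F : pred T) (G : pred U).
Variables (d : T -> T -> {set Sigma}) (e : U -> U -> {set Sigma}) (y : U).

Definition cat_final (s : T + U) : bool :=
  match s with inl t => F t && G y | inr u => G u end.

Definition cat_step (s s' : T + U) : {set Sigma} :=
  match s, s' with
  | inl t, inl t' => d t t'
  | inl t, inr u' => if F t then e y u' else finset.set0
  | inr u, inr u' => e u u'
  | inr _, inl _ => finset.set0
  end.

Lemma accepts_cat_inr u : accepts cat_final cat_step (inr u) = accepts G e u.
Proof.
apply/seteqP; split=> w; elim: w u => [//|a w IH] u /=.
  by move=> [[t'|u']] /=; rewrite ?inE // => au' /IH; exists u'.
by move=> [u' au' /IH]; exists (inr u').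
Qed.

(** Stated for every [t], since the induction on the word moves the current state. *)
Lemma accepts_cat t :
  accepts cat_final cat_step (inl t) = lang_cat (accepts F d t) (accepts G e y).
Proof.
apply/seteqP; split=> w.
  elim: w t => [|a w IH] t /=.
    by move=> /andP[tF yG]; exists [::], [::].
  move=> [[t'|u'] /=].
    move=> at' /IH [u [v [t'u yv ->]]].
    by exists (a :: u), v; split=> //; exists t'.
  case: ifP => [tF|_]; last by rewrite inE.
  rewrite accepts_cat_inr => au' u'w.
  (* The crossing transition already reads the first letter of the second factor, so the first
     factor is empty here. *)
  by exists [::], (a :: w); split=> //; exists u'.
move=> [u [v [tu yv ->]]]; elim: u t tu => [|a u IH] t /=.
  (* An empty [v] is accepted through [cat_final], a nonempty one through a crossing. *)
  move=> tF; case: v yv => [|a v] /= yv; first by rewrite tF.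
  by case: yv => u' au' u'v; exists (inr u'); rewrite /= ?tF // accepts_cat_inr.
by move=> [t' at' /IH]; exists (inl t').
Qed.

End Concatenation.

Lemma lang_star_nil (Sigma : finType) (L : language Sigma) : lang_star L [::].
Proof. by exists 0. Qed.

Lemma lang_star_cat (Sigma : finType) (L : language Sigma) (u v : seq Sigma) :
  L u -> lang_star L v -> lang_star L (u ++ v).
Proof. by move=> Lu [n _ nv]; exists n.+1 => //; exists u, v. Qed.

Section Star.
Variables (Sigma T : finType) (F : pred T) (d : T -> T -> {set Sigma}) (x : T).

(** The fresh state [None] accepts the empty word; making [x] final instead would also accept any
    path that merely returns to [x]. *)
Definition star_final (s : option T) : bool := oapp F true s.

Definition star_step (s s' : option T) : {set Sigma} :=
  match s, s' with
  | None, Some t' => d x t'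
  | Some t, Some t' => d t t' :|: (if F t then d x t' else finset.set0)
  | _, None => finset.set0
  end.

Let L : language Sigma := accepts F d x.

Lemma accepts_star_some t w :
  accepts star_final star_step (Some t) w ->
  lang_cat (accepts F d t) (lang_star L) w.
Proof.
elim: w t => [|a w IH] t /=.
  by move=> tF; exists [::], [::]; split=> //; apply: lang_star_nil.
move=> [[t'|] /=]; rewrite !inE // => /orP[at'|at'] /IH [u [v [t'u Lv ->]]].
  by exists (a :: u), v; split=> //; exists t'.
case: ifP at' => [tF at'|_]; last by rewrite inE.
(* A restart at the final state [t]: the current factor ends, and [a :: u] is a new word of [L], as
   [a] leads from [x] to [t']. *)
exists [::], (a :: u ++ v); split=> //.
by rewrite -cat_cons; apply: lang_star_cat => //; exists t'.
Qed.

(** Reading [u] ends in a final state, whose restart transitions include all those leaving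
    [None]. *)
Lemma accepts_star_some_cat t u v :
  accepts F d t u -> accepts star_final star_step None v ->
  accepts star_final star_step (Some t) (u ++ v).
Proof.
move=> tu xv; elim: u t tu => [|a u IH] t /=.
  move=> tF; case: v xv => [//|a v] /= [[t'|] /=]; rewrite ?inE // => at' t'v.
  by exists (Some t'); rewrite //= tF inE at' orbT.
by move=> [t' at' /IH]; exists (Some t'); rewrite //= inE at'.
Qed.

Lemma accepts_star : accepts star_final star_step None = lang_star L.
Proof.
apply/seteqP; split=> w.
  case: w => [_|a w /=]; first exact: lang_star_nil.
  move=> [[t'|] /=]; rewrite ?inE // => at' /accepts_star_some [u [v [t'u Lv ->]]].
  by rewrite -cat_cons; apply: lang_star_cat => //; exists t'.
move=> [n _]; elim: n w => [|n IH] w /=; first by move=> ->.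
move=> [[|a u] [v [Lu /IH xv ->]]] //.
case: Lu => t' at' t'u; exists (Some t') => //.
exact: accepts_star_some_cat.
Qed.

End Star.

Theorem theorem4p1 (Sigma : finType) (A B : counting_automaton Sigma) :
  [/\ exists C : counting_automaton Sigma,
        ca_language C = ca_language A `|` ca_language B,
      exists C : counting_automaton Sigma,
        ca_language C = lang_cat (ca_language A) (ca_language B)
    & exists C : counting_automaton Sigma,
        ca_language C = lang_star (ca_language A)].
Proof.
rewrite (ca_languageE A) (ca_languageE B); split.
- by rewrite -accepts_union; apply: accepts_recognizable.
- by rewrite -accepts_cat; apply: accepts_recognizable.
- by rewrite -accepts_star; apply: accepts_recognizable.
Qed.
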